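(* Let $\mathfrak{X}=(\Omega,S)$ be a scheme, and let $b\in S^\cup$ be a connected relation with $b=b^*$. For any nonempty subset $T$ of $\Omega$ we have \[ \frac{|\partial_b(T)|}{|T|}\geq\frac{2(1-|T|/|\Omega|)}{\mathrm{diam}(b)+|T|/|\Omega|}. \] In particular, if $|T|\leq|\Omega|/2$, then \[ \frac{|\partial_b(T)|}{|T|}\geq\frac{2}{2\,\mathrm{diam}(b)+1}. \]
   Context: Let $\Omega$ be a finite set. For a relation $a\subseteq\Omega\times\Omega$ write $a^*=\{(\beta,\alpha)\mid(\alpha,\beta)\in a\}$, and let $1_\Omega=\{(\alpha,\alpha)\mid\alpha\in\Omega\}$. A scheme (homogeneous coherent configuration) is a pair $\mathfrak{X}=(\Omega,S)$ where $S$ is a partition of $\Omega\times\Omega$ into relations such that: (1) $1_\Omega\in S$; (2) if $a\in S$ then $a^*\in S$; (3) for any $a,b,c\in S$ the number $|\{\gamma\in\Omega\mid(\alpha,\gamma)\in b,\ (\gamma,\beta)\in c\}|$ does not depend on the choice of $(\alpha,\beta)\in a$. $S^\cup$ denotes the set of all unions of relations from $S$. Relations are viewed as graphs on the vertex set $\Omega$; a relation $b$ with $b=b^*$ is an undirected graph (loops allowed), connected means connected as a graph, and $\mathrm{diam}(b)$ is the maximum distance in $b$ between two vertices. For $T\subseteq\Omega$, $\partial_b(T)=\{\beta\in\Omega\setminus T\mid(\alpha,\beta)\in b\text{ for some }\alpha\in T\}$. *)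

(* Defs.v *)
From HB Require Import structures.
From mathcomp Require Import all_boot all_order all_algebra.

Set Implicit Arguments.
Unset Strict Implicit.
Unset Printing Implicit Defensive.

Section Schemes.
Variable Omega : finType.

(* Binary relations on Omega are subsets of Omega * Omega. *)
Implicit Types (a b c : {set Omega * Omega}) (S : {set {set Omega * Omega}}).
Implicit Types (T : {set Omega}) (x y z : Omega).

Definition converse a : {set Omega * Omega} := [set (p.2, p.1) | p in a].

Definition diagonal : {set Omega * Omega} := [set p | p.1 == p.2].

Definition intersection_number b c x y : nat :=
  #|[set z | ((x, z) \in b) && ((z, y) \in c)]|.

(* [partition] excludes the empty block, so a scheme has nonempty Omega
   (otherwise [diagonal] would be an empty block). *)
Record is_scheme S : Prop := IsScheme {
  scheme_partition : partition S [set: Omega * Omega];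
  scheme_diagonal : diagonal \in S;
  scheme_converse : forall a, a \in S -> converse a \in S;
  scheme_regular : forall a b c, a \in S -> b \in S -> c \in S ->
    forall x y x' y', (x, y) \in a -> (x', y') \in a ->
    intersection_number b c x y = intersection_number b c x' y'
}.

Definition unions S : {set {set Omega * Omega}} :=
  [set cover P | P : {set {set Omega * Omega}} in powerset S].

Definition adj b : rel Omega := fun x y => (x, y) \in b.

Definition connected_graph b : Prop := forall x y, connect (adj b) x y.

Definition walk b n x y : bool :=
  [exists p : n.-tuple Omega, path (adj b) x p && (last x p == y)].

(* The least length of a walk from x to y. A shortest walk has fewer than
   #|Omega| edges, so the search bound is harmless; the result is the
   default #|Omega| exactly when y cannot be reached from x. *)
Definition distance b x y : nat :=
  find (fun n => walk b n x y) (iota 0 #|Omega|).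

Definition diam b : nat := \max_(x : Omega) \max_(y : Omega) distance b x y.

Definition boundary b T : {set Omega} :=
  [set y | (y \notin T) && [exists x in T, (x, y) \in b]].

End Schemes.

(* Main.v *)
(* For each ordered pair (x, y), send a uniformly random walk from x to y of
   length dist(x, y). Functions of (x, y) constant on the basis relations are
   closed under transposition and matrix product, so the expected number of
   visits to a vertex (starting points not counted), summed over all pairs, is
   the same for every vertex. It is therefore the average
   sum dist(x, y) / n <= diam(b) n. Every walk leaving T, and every walk into T
   starting outside T and its boundary, visits the boundary; hence
   |boundary| diam(b) n >= t (n - t) + t (n - t - |boundary|), with t = |T|. *)
Require Import Defs.
From HB Require Import structures.
From mathcomp Require Import all_boot all_order all_algebra.
From mathcomp Require Import ring lra.
Import Order.TTheory GRing.Theory Num.Theory.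
Local Open Scope ring_scope.

Set Implicit Arguments.
Unset Strict Implicit.

(** * Kernels constant on the basis relations *)

Section ClassConstant.
Context {Omega : finType} {R : comNzRingType} (S : {set {set Omega * Omega}}).
Implicit Types M N : Omega -> Omega -> R.

Definition class_constant M : Prop := forall x y x' y',
  pblock S (x, y) = pblock S (x', y') -> M x y = M x' y'.

Definition kernel_mul M N : Omega -> Omega -> R :=
  fun x y => \sum_z M x z * N z y.

(** Any pair of the given block may represent it; the value 0 is only taken on sets that are not the
    block of any pair. *)
Lemma class_constant_factor M : class_constant M ->
  exists f : {set Omega * Omega} -> R, forall x y, M x y = f (pblock S (x, y)).
Proof.
move=> hM.
exists (fun p => if [pick w | pblock S w == p] is Some w then M w.1 w.2 else 0).
move=> x y; case: pickP => [[x' y'] /eqP /= e | /(_ (x, y))]; last by rewrite eqxx.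
exact: hM.
Qed.

Hypothesis schS : is_scheme S.

Let triv : trivIset S.
Proof. by case/and3P: (scheme_partition schS). Qed.

Lemma pblock_scheme w : pblock S w \in S.
Proof.
by apply: pblock_mem; case/and3P: (scheme_partition schS) => /eqP-> _ _; rewrite inE.
Qed.

Lemma mem_pblock_scheme w : w \in pblock S w.
Proof.
by rewrite mem_pblock; case/and3P: (scheme_partition schS) => /eqP-> _ _; rewrite inE.
Qed.

Lemma pblock_scheme_eq a w : a \in S -> (pblock S w == a) = (w \in a).
Proof.
move=> aS; apply/eqP/idP => [<- | wa]; first exact: mem_pblock_scheme.
exact: def_pblock.
Qed.

Lemma pblock_diag x y : pblock S (x, x) = pblock S (y, y).
Proof.
have D z : pblock S (z, z) = diagonal Omega.
  by apply/eqP; rewrite pblock_scheme_eq ?(scheme_diagonal schS)// inE /=.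
by rewrite !D.
Qed.

(** Sort the middle vertices z by the blocks p of (u, z) and q of (z, v): each contributes f p * g
    q, and their number is an intersection number, which depends only on the block of (u, v). *)
Lemma class_constant_mul M N :
  class_constant M -> class_constant N -> class_constant (kernel_mul M N).
Proof.
move=> /class_constant_factor[f hf] /class_constant_factor[g hg] x y x' y' e.
have E u v : kernel_mul M N u v = \sum_(p in S) \sum_(q in S)
    f p * g q *+ intersection_number p q u v.
  rewrite /kernel_mul.
  rewrite (partition_big (fun z => pblock S (u, z)) (mem S)) /=; last first.
    by move=> z _; exact: pblock_scheme.
  apply: eq_bigr => p pS.
  rewrite (partition_big (fun z => pblock S (z, v)) (mem S)) /=; last first.
    by move=> z _; exact: pblock_scheme.
  apply: eq_bigr => q qS.
  rewrite /intersection_number -sumr_const; apply: eq_big => z.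
    by rewrite inE !pblock_scheme_eq.
  by case/andP=> /eqP <- /eqP <-; rewrite hf hg.
rewrite !E; apply: eq_bigr => p pS; apply: eq_bigr => q qS.
congr (_ *+ _).
apply: (scheme_regular schS (pblock_scheme (x, y)) pS qS).
  exact: mem_pblock_scheme.
by rewrite e mem_pblock_scheme.
Qed.

(** The block of (y, x) is the converse of the block of (x, y), hence determined by it. *)
Lemma class_constant_transpose M :
  class_constant M -> class_constant (fun x y => M y x).
Proof.
move=> hM x y x' y' e; apply: hM.
have C u v : (v, u) \in converse (pblock S (u, v)).
  by apply/imsetP; exists (u, v) => //; exact: mem_pblock_scheme.
have cS := scheme_converse schS (pblock_scheme (x, y)).
by rewrite (def_pblock triv cS (C x y)) e -(def_pblock triv _ (C x' y')) -?e.
Qed.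

Lemma class_constant_mem b : b \in unions S ->
  class_constant (fun x y => ((x, y) \in b)%:R).
Proof.
case/imsetP=> P; rewrite inE => /subsetP sPS -> x y x' y' e.
have E w : (w \in cover P) = (pblock S w \in P).
  apply/bigcupP/idP => [[a aP wa]|h]; last by exists (pblock S w); rewrite ?mem_pblock_scheme.
  by rewrite (def_pblock triv (sPS _ aP) wa).
by rewrite !E e.
Qed.

Lemma class_constant_eq : class_constant (fun x y => (x == y)%:R).
Proof.
have E x y : (x == y) = (pblock S (x, y) == diagonal Omega).
  by rewrite pblock_scheme_eq ?(scheme_diagonal schS)// inE.
by move=> x y x' y' e; rewrite !E e.
Qed.

End ClassConstant.

(** * Counting walks and their visits *)

Section Walks.
Context {Omega : finType} (b : {set Omega * Omega}).
Implicit Types (x y z v : Omega) (U B T : {set Omega}).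

(** Powers of the adjacency matrix, taken over the rationals so that averages over walks are
    quotients. *)
Fixpoint walks n : Omega -> Omega -> rat :=
  if n is m.+1 then kernel_mul (fun x y => ((x, y) \in b)%:R) (walks m)
  else fun x y => (x == y)%:R.

Lemma walksS n x y : walks n.+1 x y = \sum_(z | (x, z) \in b) walks n z y.
Proof.
rewrite /= /kernel_mul [RHS]big_mkcond; apply: eq_bigr => z _.
by case: ifP; rewrite ?mul1r ?mul0r.
Qed.

Lemma walks_ge0 n x y : 0 <= walks n x y.
Proof.
elim: n x => [|n IH] x; first exact: ler0n.
by rewrite walksS; apply: sumr_ge0.
Qed.

Lemma walks_add m n x y :
  \sum_v walks m x v * walks n v y = walks (m + n) x y.
Proof.
elim: m x => [|m IH] x.
  rewrite (bigD1 x) //= eqxx mul1r big1 ?addr0 // => v /negPf.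
  by rewrite eq_sym => ->; rewrite mul0r.
rewrite addSn walksS -(eq_bigr _ (fun z _ => IH z)) exchange_big /=.
by apply: eq_bigr => v _; rewrite -/(walks m.+1 x v) walksS mulr_suml.
Qed.

Lemma walkE n x y : walk b n x y = (0 < walks n x y).
Proof.
elim: n x => [|n IH] x.
  rewrite /= ltr0n lt0b; apply/existsP/idP => [[p]|/eqP->].
    by rewrite tuple0.
  by exists [tuple]; rewrite /= eqxx.
rewrite walksS lt_def sumr_ge0 ?andbT; last by move=> *; exact: walks_ge0.
rewrite psumr_neq0; last by move=> *; exact: walks_ge0.
apply/existsP/hasP => [[p]|[z _ /andP[xz]]].
  case/tupleP: p => z p /= /andP[/andP[xz hp] hl].
  exists z; first exact: mem_index_enum.
  by rewrite [(x, z) \in b]xz -IH; apply/existsP; exists p; rewrite hp hl.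
rewrite -IH => /existsP[p /andP[hp hl]].
by exists [tuple of z :: p]; rewrite /= hp hl !andbT.
Qed.

Lemma distance_walk x y : connected_graph b ->
  0 < walks (distance b x y) x y.
Proof.
move=> conn; rewrite -walkE /distance.
set s := iota _ _.
have hs : has (fun n => walk b n x y) s.
  have /connectP[p hp ->] := conn x y.
  case/shortenP: hp => q hq uq _.
  (* A path without repeated vertices has fewer than [#|Omega|] edges, so the search in [distance]
     succeeds before its default. *)
  apply/hasP; exists (size q).
    rewrite mem_iota /= add0n.
    by have := card_uniqP uq; move=> /= <-; exact: max_card.
  by apply/existsP; exists (in_tuple q); rewrite hq eqxx.
have := nth_find 0%N hs; rewrite nth_iota ?add0n //.
by rewrite -[X in (_ < X)%N](size_iota 0) -has_find.
Qed.

Lemma distance_le_diam x y : (distance b x y <= diam b)%N.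
Proof.
apply: leq_trans (leq_bigmax x).
exact: (leq_bigmax (F := fun y => distance b x y)).
Qed.

(** Visits to v at positions 1 to k, totalled over all walks of length k from x to y: the end
    counts, the start does not. *)
Definition passages k x y v : rat :=
  \sum_(i < k) walks i.+1 x v * walks (k - i.+1) v y.

Lemma passages_ge0 k x y v : 0 <= passages k x y v.
Proof. by apply: sumr_ge0 => i _; rewrite mulr_ge0 ?walks_ge0. Qed.

Lemma sum_passages k x y : \sum_v passages k x y v = k%:R * walks k x y.
Proof.
rewrite exchange_big /= (eq_bigr (fun=> walks k x y)) => [|i _].
  by rewrite sumr_const card_ord mulr_natl.
by rewrite -[LHS]/(\sum_v walks i.+1 x v * walks (k - i.+1) v y) walks_add subnKC.
Qed.

(** Condition on the first step z: position 1 is a visit when z is v, and later positions belong to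
    the walk from z. *)
Lemma passagesS k x y v :
  passages k.+1 x y v =
  \sum_(z | (x, z) \in b) ((z == v)%:R * walks k v y + passages k z y v).
Proof.
rewrite /passages big_ord_recl big_split subSS subn0; congr (_ + _).
  by rewrite walksS mulr_suml.
rewrite [RHS]exchange_big; apply: eq_bigr => i _.
by rewrite -mulr_suml -walksS lift0 subSS.
Qed.

(* A walk leaving U hits B at the first vertex outside U. *)
Lemma walks_le_passages U B k x y :
  (forall u z, u \in U -> (u, z) \in b -> z \in U :|: B) ->
  y \notin U -> x \in U ->
  walks k x y <= \sum_(v in B) passages k x y v.
Proof.
move=> sep yU; elim: k x => [|k IH] x xU.
  have /negPf nxy : x != y by apply: contraNneq yU => <-.
  rewrite /= nxy; apply: sumr_ge0 => v _; exact: passages_ge0.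
under eq_bigr do rewrite passagesS.
rewrite exchange_big walksS; apply: ler_sum => z xz.
rewrite big_split /=.
have := sep x z xU xz; rewrite inE => /orP[zU|zB].
  apply: le_trans (IH _ zU) _; rewrite lerDr; apply: sumr_ge0 => v _.
  by rewrite mulr_ge0 ?ler0n ?walks_ge0.
(* The first step lands in B, so the term v = z alone accounts for every walk continuing from z. *)
rewrite (bigD1 z) //= eqxx mul1r -addrA lerDl addr_ge0 //.
  by apply: sumr_ge0 => v _; rewrite mulr_ge0 ?ler0n ?walks_ge0.
by apply: sumr_ge0 => v _; exact: passages_ge0.
Qed.

(* The expected number of visits to v after the start, for a uniformly random
   walk of length [distance b x y] from x to y. *)
Definition visits x y v : rat :=
  passages (distance b x y) x y v / walks (distance b x y) x y.

Lemma visits_ge0 x y v : 0 <= visits x y v.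
Proof. by rewrite divr_ge0 ?passages_ge0 ?walks_ge0. Qed.

Lemma sum_visits x y : connected_graph b ->
  \sum_v visits x y v = (distance b x y)%:R.
Proof.
move=> conn; rewrite -mulr_suml sum_passages mulfK //.
by rewrite gt_eqF ?distance_walk.
Qed.

Lemma sum_visits_ge1 U B x y : connected_graph b ->
  (forall u z, u \in U -> (u, z) \in b -> z \in U :|: B) ->
  y \notin U -> x \in U -> 1 <= \sum_(v in B) visits x y v.
Proof.
move=> conn sep yU xU; rewrite -mulr_suml ler_pdivlMr ?distance_walk //.
by rewrite mul1r; exact: walks_le_passages sep yU xU.
Qed.

(** Summing over all lengths k, with an indicator of the distance, gives summands that are products
    of kernels of fixed length. *)
Lemma visits_sum_length x y v :
  visits x y v = \sum_(k < (diam b).+1) \sum_(i < k)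
    walks i.+1 x v *
    (walks (k - i.+1) v y * ((distance b x y == k)%:R / walks k x y)).
Proof.
have hd : (distance b x y < (diam b).+1)%N by rewrite ltnS distance_le_diam.
rewrite (bigD1 (Ordinal hd)) //= [X in _ + X]big1 => [|k hk].
  rewrite addr0 /visits mulr_suml; apply: eq_bigr => i _.
  by rewrite eqxx mul1r mulrA.
apply: big1 => i _; have /negPf-> : distance b x y != k.
  by apply: contra hk => /eqP e; apply/eqP/val_inj.
by rewrite mul0r !mulr0.
Qed.

Definition load v : rat := \sum_x \sum_y visits x y v.

Lemma sum_load_le : connected_graph b ->
  \sum_v load v <= (diam b)%:R * #|Omega|%:R ^+ 2.
Proof.
move=> conn; rewrite exchange_big /=.
apply: le_trans (_ : \sum_(x : Omega) \sum_(y : Omega) (diam b)%:R <= _).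
  apply: ler_sum => x _; rewrite exchange_big /=; apply: ler_sum => y _.
  by rewrite sum_visits // ler_nat distance_le_diam.
by rewrite !sumr_const -mulrnA -natrX mulr_natr mulnn.
Qed.

(** * Equal loads in a scheme *)

Section Scheme.
Variable S : {set {set Omega * Omega}}.
Hypotheses (schS : is_scheme S) (bS : b \in unions S).

Lemma class_constant_walks n : class_constant S (walks n).
Proof.
elim: n => [|n IH]; first exact: class_constant_eq.
by apply: class_constant_mul => //; exact: class_constant_mem.
Qed.

Lemma distance_class_constant x y x' y' :
  pblock S (x, y) = pblock S (x', y') -> distance b x y = distance b x' y'.
Proof.
move=> e; apply: eq_find => n.
by rewrite !walkE (class_constant_walks _ e).
Qed.

(* The load is a sum of diagonal entries of products of class-constant
   kernels. *)
Lemma load_constant u v : load u = load v.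
Proof.
(* [N k] selects the pairs at distance k and normalizes; transposed, it closes the circuit from w to
   y to x and back to w. *)
pose N k x y : rat := (distance b x y == k)%:R / walks k x y.
have hN k : class_constant S (fun x y => N k y x).
  apply: class_constant_transpose => // x y x' y' e.
  by rewrite /N (distance_class_constant e) (class_constant_walks _ e).
have E w : load w = \sum_(k < (diam b).+1) \sum_(i < k)
    kernel_mul (kernel_mul (walks (k - i.+1)) (fun x y => N k y x))
      (walks i.+1) w w.
  rewrite /load; under eq_bigr do under eq_bigr do rewrite visits_sum_length.
  under eq_bigr do rewrite exchange_big.
  rewrite exchange_big; apply: eq_bigr => k _ /=.
  under eq_bigr do rewrite exchange_big.
  rewrite exchange_big; apply: eq_bigr => i _ /=.
  by apply: eq_bigr => x _; rewrite /kernel_mul mulrC mulr_sumr.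
rewrite !E; apply: eq_bigr => k _; apply: eq_bigr => i _.
have h := class_constant_walks.
apply: (class_constant_mul schS (class_constant_mul schS (h _) (hN k)) (h _)).
exact: pblock_diag.
Qed.

(** A constant load equals its average, so the bound on the total is divided by [#|Omega|]. *)
Lemma load_le v : connected_graph b -> load v <= (diam b)%:R * #|Omega|%:R.
Proof.
move=> conn; have := sum_load_le conn.
rewrite (eq_bigr (fun=> load v)) => [|u _]; last exact: load_constant.
rewrite sumr_const -[load v *+ _]mulr_natr expr2 mulrA ler_pM2r // ltr0n.
by apply/card_gt0P; exists v.
Qed.

(* Ordered pairs from T to its complement contribute t(n - t) to the load of
   the boundary B; those from the complement to T contribute t(n - t - |B|),
   since the start of a walk is not counted and so must lie off B. *)
Lemma boundary_card_bound T : connected_graph b -> b = converse b ->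
  2 * #|T|%:R * (#|Omega|%:R - #|T|%:R) <=
  #|boundary b T|%:R * ((diam b)%:R * #|Omega|%:R + #|T|%:R) :> rat.
Proof.
move=> conn symb; set B := boundary b T.
have bC x y : (x, y) \in b -> (y, x) \in b.
  by move=> xy; rewrite symb; apply/imsetP; exists (x, y).
have sepT u z : u \in T -> (u, z) \in b -> z \in T :|: B.
  move=> uT uz; rewrite !inE; case: (z \in T) => //=.
  by apply/existsP; exists u; rewrite uT.
have sepC u z : u \in ~: (T :|: B) -> (u, z) \in b -> z \in ~: (T :|: B) :|: B.
  rewrite in_setU !in_setC !in_setU !negb_or => /andP[uT uB] uz.
  case: (boolP (z \in B)) => [|zB]; rewrite ?orbT // orbF andbT.
  (* By symmetry of [b], a step from u into T would put u in the boundary. *)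
  apply: contra uB => zT; rewrite inE uT; apply/existsP; exists z.
  by rewrite zT bC.
have upper : \sum_(v in B) load v <= #|B|%:R * ((diam b)%:R * #|Omega|%:R).
  rewrite mulr_natl -sumr_const; apply: ler_sum => v _; exact: load_le.
have lower : #|T|%:R * #|~: T|%:R + #|~: (T :|: B)|%:R * #|T|%:R
    <= \sum_(v in B) load v.
  rewrite exchange_big /=.
  under eq_bigr do rewrite exchange_big /=.
  rewrite (bigID (mem T)) /=; apply: lerD.
    rewrite !mulr_natl -sumr_const; apply: ler_sum => x xT.
    rewrite -sumr_const [leRHS](bigID (mem T)) /=.
    rewrite ler_wpDl //; first by do 2!apply: sumr_ge0 => ? _; apply: visits_ge0.
    rewrite (eq_bigl (fun y => y \notin T)) => [|y]; last by rewrite inE.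
    by apply: ler_sum => y yT; exact: sum_visits_ge1 sepT _ _.
  rewrite (bigID (mem B)) /= ler_wpDl //.
    by do 3!apply: sumr_ge0 => ? _; apply: visits_ge0.
  rewrite mulr_natl -sumr_const.
  rewrite [leRHS](eq_bigl (fun x => x \in ~: (T :|: B))) => [|x]; last first.
    by rewrite in_setC in_setU negb_or.
  apply: ler_sum => x xC; rewrite -sumr_const [leRHS](bigID (mem T)) /=.
  rewrite ler_wpDr //; first by do 2!apply: sumr_ge0 => ? _; apply: visits_ge0.
  apply: ler_sum => y yT; apply: sum_visits_ge1 sepC _ _ => //.
  by rewrite in_setC in_setU yT.
have cT : #|~: T|%:R = #|Omega|%:R - #|T|%:R :> rat.
  by rewrite -(cardsC T) natrD addrC addKr.
have cTB : #|~: (T :|: B)|%:R = #|Omega|%:R - #|T|%:R - #|B|%:R :> rat.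
  rewrite -(cardsC (T :|: B)) cardsU.
  have -> : T :&: B = set0.
    by apply/setP => z; rewrite !inE; case: (z \in T).
  by rewrite cards0 subn0 !natrD; ring.
have := le_trans lower upper; rewrite cT cTB; lra.
Qed.

End Scheme.
End Walks.

Theorem proposition2p2 (Omega : finType) (S : {set {set Omega * Omega}})
    (b : {set Omega * Omega}) (T : {set Omega}) :
  is_scheme S -> b \in unions S -> connected_graph b -> b = converse b ->
  T != set0 ->
  (#|boundary b T|%:R / #|T|%:R : rat) >=
    2 * (1 - #|T|%:R / #|Omega|%:R) /
      ((diam b)%:R + #|T|%:R / #|Omega|%:R)
  /\ ((#|T|%:R : rat) <= #|Omega|%:R / 2 ->
      (#|boundary b T|%:R / #|T|%:R : rat) >= 2 / (2 * (diam b)%:R + 1)).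
Proof.
move=> schS bS conn symb T0.
have := boundary_card_bound schS bS T conn symb.
have t0 : 0 < #|T|%:R :> rat by rewrite ltr0n card_gt0.
have tn : #|T|%:R <= #|Omega|%:R :> rat by rewrite ler_nat max_card.
have d0 : 0 <= (diam b)%:R :> rat := ler0n _ _.
move: #|boundary b T|%:R (diam b)%:R d0 #|T|%:R #|Omega|%:R t0 tn.
move=> e d d0 t n t0 tn key.
have n0 : 0 < n := lt_le_trans t0 tn.
have main : 2 * (1 - t / n) / (d + t / n) <= e / t.
  have dn : 0 <= d * n by rewrite mulr_ge0 // ltW.
  have -> : 2 * (1 - t / n) / (d + t / n) = 2 * (n - t) / (d * n + t).
    field; by rewrite !gt_eqF //; lra.
  rewrite ler_pdivrMr; last lra.
  by rewrite mulrAC ler_pdivlMr //; lra.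
split=> // tn2; apply: le_trans main.
have u0 : 0 < t / n by rewrite divr_gt0.
have u2 : t / n <= 2^-1 by rewrite ler_pdivrMr //; lra.
(* 2(1 - u)/(d + u) decreases in u and equals 2/(2d + 1) at u = 1/2. *)
move: (t / n) u0 u2 => u u0 u2.
rewrite ler_pdivrMr; last lra.
by rewrite mulrAC ler_pdivlMr; [nra | lra].
Qed.
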